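(* The dagger category of tame relations $\mathrm{TRel}(\mathbf{Conv},\mathrm{cp})$, for the comparison cluster $\mathrm{cp}_X\colon\mathcal{D}(X)\otimes\mathcal{D}(X)\to[0,1]$ indexed by sets $X$ and given by $\mathrm{cp}_X(\varphi\otimes\varphi')=\sum_x\varphi(x)\cdot\varphi'(x)$, has sets as objects and as morphisms $X\to Y$ the discrete bistochastic relations $r\colon X\times Y\to[0,1]$, i.e. those satisfying both: $$\left\{\begin{array}{l}X\to[0,1]^Y\ \text{factors through}\ X\to\mathcal{D}(Y),\\ Y\to[0,1]^X\ \text{factors through}\ Y\to\mathcal{D}(X).\end{array}\right.$$
   Context: $\mathcal{D}(X)=\{\varphi\colon X\to[0,1]\mid\varphi\text{ has finite support and }\sum_{x}\varphi(x)=1\}$ is the set of discrete probability distributions on $X$; $\mathcal{D}$ is a commutative monad on $\mathbf{Sets}$. $\mathbf{Conv}$ is its category of Eilenberg-Moore algebras: convex sets and affine maps, with trivial (identity) involution. $\mathcal{D}(X)$ is the free convex set on $X$; $[0,1]=\mathcal{D}(2)$ as a convex set. The tensor $\otimes$ on $\mathbf{Conv}$ classifies maps that are affine in each argument separately, and $\mathcal{D}(X)\otimes\mathcal{D}(Y)\cong\mathcal{D}(X\times Y)$. Hence functions $r\colon X\times Y\to[0,1]$ correspond bijectively to affine maps $\widehat r\colon\mathcal{D}(X)\otimes\mathcal{D}(Y)\to[0,1]$, via $\widehat r(\varphi\otimes\psi)=\sum_{x,y}\varphi(x)\cdot r(x,y)\cdot\psi(y)$. The maps $X\to[0,1]^Y$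 and $Y\to[0,1]^X$ in the claim are $x\mapsto r(x,-)$ and $y\mapsto r(-,y)$. $\mathrm{TRel}(\mathbf{Conv},\mathrm{cp})$ has sets as objects. Morphisms $X\to Y$ are tame relations: affine maps $r\colon\mathcal{D}(X)\otimes\mathcal{D}(Y)\to[0,1]$ for which there are (necessarily unique) affine maps $r_*\colon\mathcal{D}(X)\to\mathcal{D}(Y)$ and $r^*\colon\mathcal{D}(Y)\to\mathcal{D}(X)$ with $\mathrm{cp}_Y\circ(r_*\otimes\mathrm{id})=r=\mathrm{cp}_X\circ(\mathrm{id}\otimes r^* )$. Identities are the $\mathrm{cp}_X$, composition is $s\bullet r=s\circ(r_*\otimes\mathrm{id})$, and the dagger is $r^\dagger=\mathrm{cp}_X\circ(r^*\otimes\mathrm{id})$. The claim identifies tame relations with functions $X\times Y\to[0,1]$ via $r\leftrightarrow\widehat r$. *)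

(* Defs.v *)
From mathcomp Require Import all_boot all_order all_algebra.
From mathcomp Require Import boolp classical_sets functions cardinality fsbigop.
From mathcomp Require Import reals interval_inference.

Set Implicit Arguments.
Unset Strict Implicit.
Unset Printing Implicit Defensive.

Import Order.TTheory GRing.Theory Num.Theory.
Local Open Scope classical_set_scope.
Local Open Scope ring_scope.

(** * Discrete probability distributions *)

(* The sum of a finitely supported function.  Sets are arbitrary types;
   [{classic X}] only provides the decidable equality required by [\sum_]. *)
Definition fsum (R : realType) (X : Type) (f : X -> R) : R :=
  \sum_(x \in [set: {classic X}]) f x.

Record dist (R : realType) (X : Type) := Dist {
  prob :> X -> {i01 R};
  dist_finite : finite_set [set x | (prob x)%:num != 0];
  dist_sum1 : fsum (fun x => (prob x)%:num) = 1 }.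

Definition expect (R : realType) (X : Type) (phi : dist R X) (g : X -> R) : R :=
  fsum (fun x => (phi x)%:num * g x).

Section Fsum.
Context (R : realType).

Lemma fsum_seq (X : Type) (s : seq {classic X}) (f : X -> R) : uniq s ->
  (forall x : {classic X}, x \notin s -> f x = 0) ->
  fsum f = \sum_(x <- s) f x.
Proof.
by move=> us f0; rewrite /fsum (fsbigE s)//; [apply: eq_bigl => x; rewrite in_setT
  | move=> x _; apply: f0].
Qed.

Lemma eq_fsum (X : Type) (f g : X -> R) : f =1 g -> fsum f = fsum g.
Proof. by move=> fg; congr fsum; apply/funext. Qed.

Lemma dist_seq (X : Type) (phi : dist R X) : exists s : seq {classic X},
  uniq s /\ forall x : {classic X}, x \notin s -> (phi x)%:num = 0.
Proof.
have /(@finite_seqP {classic X})[s sE] := dist_finite phi.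
exists (undup s); split; first exact: undup_uniq.
move=> x; rewrite mem_undup => xs; apply/eqP; apply: contraNT xs => px.
by have : [set` s] x by rewrite -sE.
Qed.

Lemma expect_seq (X : Type) (phi : dist R X) (s : seq {classic X}) (g : X -> R) :
  uniq s -> (forall x : {classic X}, x \notin s -> (phi x)%:num = 0) ->
  expect phi g = \sum_(x <- s) (phi x)%:num * g x.
Proof. by move=> us s0; apply: fsum_seq => // x /s0 ->; rewrite mul0r. Qed.

Lemma expect1 (X : Type) (phi : dist R X) : expect phi (fun=> 1) = 1.
Proof. by rewrite -[RHS](dist_sum1 phi); apply: eq_fsum => x; rewrite mulr1. Qed.

Lemma eq_expect (X : Type) (phi : dist R X) (f g : X -> R) :
  f =1 g -> expect phi f = expect phi g.
Proof. by move=> /funext ->. Qed.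

Lemma expect_ge0 (X : Type) (phi : dist R X) (g : X -> R) :
  (forall x, 0 <= g x) -> 0 <= expect phi g.
Proof.
move=> g0; have [s [us s0]] := dist_seq phi; rewrite (expect_seq _ us s0).
by apply: sumr_ge0 => x _; rewrite mulr_ge0.
Qed.

Lemma expect_le1 (X : Type) (phi : dist R X) (g : X -> R) :
  (forall x, g x <= 1) -> expect phi g <= 1.
Proof.
move=> g1; rewrite -[leRHS](expect1 phi).
have [s [us s0]] := dist_seq phi; rewrite !(expect_seq _ us s0).
by apply: ler_sum => x _; rewrite ler_wpM2l.
Qed.

Lemma i01_ge0 (x : {i01 R}) : 0 <= x%:num. Proof. by []. Qed.
Lemma i01_le1 (x : {i01 R}) : x%:num <= 1. Proof. by []. Qed.

Lemma dist_ext (X : Type) (phi psi : dist R X) :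
  (forall x, (phi x)%:num = (psi x)%:num) -> phi = psi.
Proof.
case: phi psi => [f ff f1] [g gf g1]/= fg.
have fgE : f = g by apply/funext => x; apply/val_inj/fg.
by subst g; congr Dist; exact: Prop_irrelevance.
Qed.

End Fsum.

(** * The distribution monad *)

Section Monad.
Context (R : realType).

Lemma indic_le1 (P : Prop) : (`[< P >])%:R <= 1 :> R.
Proof. by case: asboolP. Qed.

Definition ret_fun (X : Type) (x y : X) : {i01 R} :=
  Itv01 (ler0n R `[< x = y >]) (indic_le1 (x = y)).

Lemma ret_finite (X : Type) (x : X) :
  finite_set [set y | (ret_fun x y)%:num != 0].
Proof.
apply: (sub_finite_set _ (finite_set1 x)) => y /=.
by case: asboolP => //= _; rewrite eqxx.
Qed.

Lemma sum_indic (X : Type) (s : seq {classic X}) (x : {classic X}) (g : X -> R) :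
  uniq s -> x \in s -> \sum_(y <- s) (`[< x = y >])%:R * g y = g x.
Proof.
move=> us xs; rewrite (bigD1_seq x)//= big1 ?addr0.
  by case: asboolP => // _; rewrite mul1r.
by move=> y yx; case: asboolP => [xy|_]; [rewrite xy eqxx in yx | rewrite mul0r].
Qed.

Lemma fsum_indic (X : Type) (x : X) (g : X -> R) :
  fsum (fun y => (`[< x = y >])%:R * g y) = g x.
Proof.
rewrite (@fsum_seq _ _ [:: x : {classic X}])//=; last move=> y.
  exact: (@sum_indic X [:: x : {classic X}] x g _ (mem_head _ _)).
rewrite inE => yx; case: asboolP => [xy|_]; last by rewrite mul0r.
by rewrite xy eqxx in yx.
Qed.

Lemma ret_sum1 (X : Type) (x : X) : fsum (fun y => (ret_fun x y)%:num) = 1.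
Proof.
by rewrite -[RHS](fsum_indic x (fun=> 1)); apply: eq_fsum => y; rewrite mulr1.
Qed.

Definition dist_ret (X : Type) (x : X) : dist R X :=
  Dist (ret_finite x) (ret_sum1 x).

Lemma expect_ret (X : Type) (x : X) (g : X -> R) : expect (dist_ret x) g = g x.
Proof. exact: fsum_indic. Qed.

Lemma expect_retr (X : Type) (phi : dist R X) (y : X) :
  expect phi (fun x => (dist_ret x y)%:num) = (phi y)%:num.
Proof.
rewrite -[RHS](fsum_indic y (fun z => (phi z)%:num)); apply: eq_fsum => x /=.
have -> : `[< x = y >] = `[< y = x >] by apply: asbool_equiv_eq; split.
exact: mulrC.
Qed.

Definition bind_fun (X Y : Type) (phi : dist R X) (k : X -> dist R Y) (y : Y)
    : {i01 R} :=
  Itv01 (expect_ge0 phi (fun x => i01_ge0 (k x y)))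
        (expect_le1 phi (fun x => i01_le1 (k x y))).

Lemma bind_seq (X Y : Type) (phi : dist R X) (k : X -> dist R Y)
    (s : seq {classic X}) :
  exists t : seq {classic Y}, uniq t /\
    forall x : {classic X}, x \in s -> forall y : {classic Y}, y \notin t ->
      (k x y)%:num = 0.
Proof.
elim: s => [|x s [t [ut t0]]]; first by exists [::].
have [u [uu u0]] := dist_seq (k x).
exists (undup (t ++ u)); split; first exact: undup_uniq.
move=> z; rewrite inE => /orP[/eqP -> |zs] y;
  rewrite mem_undup mem_cat negb_or => /andP[yt yu]; first exact: u0.
exact: t0.
Qed.

Lemma fsum_bind (X Y : Type) (phi : dist R X) (k : X -> dist R Y) (g : Y -> R) :
  fsum (fun y => expect phi (fun x => (k x y)%:num) * g y) =
  expect phi (fun x => expect (k x) g).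
Proof.
have [s [us s0]] := dist_seq phi; have [t [ut t0]] := bind_seq phi k s.
rewrite (expect_seq _ us s0) (@fsum_seq _ _ t)//=; last first.
  move=> y yt; rewrite (expect_seq _ us s0) big_seq big1 ?mul0r// => x xs.
  by rewrite t0 ?mulr0.
under eq_bigr do rewrite (expect_seq _ us s0) mulr_suml.
rewrite exchange_big/= big_seq [RHS]big_seq; apply: eq_bigr => x xs.
rewrite (expect_seq _ ut (t0 x xs)) mulr_sumr.
by apply: eq_bigr => y _; rewrite mulrA.
Qed.

Lemma bind_finite (X Y : Type) (phi : dist R X) (k : X -> dist R Y) :
  finite_set [set y | (bind_fun phi k y)%:num != 0].
Proof.
have [s [us s0]] := dist_seq phi; have [t [ut t0]] := bind_seq phi k s.
apply: (sub_finite_set (B := [set` t])) => [y /=|]; last first.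
  by apply/(@finite_seqP {classic Y}); exists t.
apply: contraNT => yt; rewrite (expect_seq _ us s0) big_seq big1// => x xs.
by rewrite t0 ?mulr0.
Qed.

Lemma bind_sum1 (X Y : Type) (phi : dist R X) (k : X -> dist R Y) :
  fsum (fun y => (bind_fun phi k y)%:num) = 1.
Proof.
transitivity (expect phi (fun x => expect (k x) (fun=> 1))).
  by rewrite -fsum_bind; apply: eq_fsum => y; rewrite mulr1.
by rewrite -[RHS](expect1 phi); apply: eq_expect => x; exact: expect1.
Qed.

Definition dist_bind (X Y : Type) (phi : dist R X) (k : X -> dist R Y)
    : dist R Y :=
  Dist (bind_finite phi k) (bind_sum1 phi k).

Lemma expect_bind (X Y : Type) (phi : dist R X) (k : X -> dist R Y) (g : Y -> R) :
  expect (dist_bind phi k) g = expect phi (fun x => expect (k x) g).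
Proof. exact: fsum_bind. Qed.

Definition dist_map (X Y : Type) (f : X -> Y) (phi : dist R X) : dist R Y :=
  dist_bind phi (fun x => dist_ret (f x)).

Definition dist_join (X : Type) (Phi : dist R (dist R X)) : dist R X :=
  dist_bind Phi id.

Lemma bind_ret (X Y : Type) (x : X) (k : X -> dist R Y) :
  dist_bind (dist_ret x) k = k x.
Proof. by apply: dist_ext => y /=; rewrite expect_ret. Qed.

Lemma bindr_ret (X : Type) (phi : dist R X) :
  dist_bind phi (@dist_ret X) = phi.
Proof. by apply: dist_ext => y /=; rewrite -[RHS]expect_retr. Qed.

Lemma bind_bind (X Y Z : Type) (phi : dist R X) (k : X -> dist R Y)
    (l : Y -> dist R Z) :
  dist_bind (dist_bind phi k) l = dist_bind phi (fun x => dist_bind (k x) l).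
Proof. by apply: dist_ext => z /=; rewrite expect_bind. Qed.

Lemma eq_bind (X Y : Type) (phi : dist R X) (k l : X -> dist R Y) :
  k =1 l -> dist_bind phi k = dist_bind phi l.
Proof. by move=> /funext ->. Qed.

Lemma map_ret (X Y : Type) (f : X -> Y) (x : X) :
  dist_map f (dist_ret x) = dist_ret (f x).
Proof. exact: bind_ret. Qed.

Lemma dist_map_id (X : Type) (phi : dist R X) : dist_map id phi = phi.
Proof. exact: bindr_ret. Qed.

Lemma bind_map (X Y Z : Type) (f : X -> Y) (k : Y -> dist R Z) (phi : dist R X) :
  dist_bind (dist_map f phi) k = dist_bind phi (k \o f).
Proof. by rewrite bind_bind; apply: eq_bind => x; rewrite bind_ret. Qed.

Lemma dist_map_comp (X Y Z : Type) (g : Y -> Z) (f : X -> Y) (phi : dist R X) :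
  dist_map g (dist_map f phi) = dist_map (g \o f) phi.
Proof. exact: bind_map. Qed.

Lemma map_bind (X Y Z : Type) (g : Y -> Z) (k : X -> dist R Y) (phi : dist R X) :
  dist_map g (dist_bind phi k) = dist_bind phi (fun x => dist_map g (k x)).
Proof. exact: bind_bind. Qed.

Lemma map_join (X Y : Type) (f : X -> Y) (Phi : dist R (dist R X)) :
  dist_map f (dist_join Phi) = dist_join (dist_map (dist_map f) Phi).
Proof. by rewrite map_bind /dist_join bind_map. Qed.

Lemma expect_map (X Y : Type) (f : X -> Y) (phi : dist R X) (g : Y -> R) :
  expect (dist_map f phi) g = expect phi (g \o f).
Proof. by rewrite expect_bind; apply: eq_expect => x; rewrite expect_ret. Qed.

End Monad.

(** * Convex sets: Eilenberg-Moore algebras of [dist R] *)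

Record convex (R : realType) := Convex {
  pt :> Type;
  bary : dist R pt -> pt;
  bary_ret : forall a : pt, bary (dist_ret R a) = a;
  bary_join : forall Phi : dist R (dist R pt),
    bary (dist_join Phi) = bary (dist_map bary Phi) }.

Definition is_affine (R : realType) (A B : convex R) (f : A -> B) : Prop :=
  forall phi : dist R A, f (bary phi) = bary (dist_map f phi).

Record affine (R : realType) (A B : convex R) := Affine {
  afun :> A -> B;
  affineP : is_affine afun }.

Definition is_biaffine (R : realType) (A B C : convex R) (f : A -> B -> C) : Prop :=
  (forall b, is_affine (fun a => f a b)) /\ (forall a, is_affine (f a)).

Section Affine.
Context (R : realType).

Lemma affine_ext (A B : convex R) (f g : affine A B) : f =1 g -> f = g.
Proof.
case: f g => [f fP] [g gP] /= /funext fg; subst g.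
by congr Affine; exact: Prop_irrelevance.
Qed.

Lemma id_affine (A : convex R) : is_affine (@id A).
Proof. by move=> phi; rewrite dist_map_id. Qed.

Definition aff_id (A : convex R) : affine A A := Affine (@id_affine A).

Lemma comp_affine (A B C : convex R) (g : affine B C) (f : affine A B) :
  is_affine (g \o f).
Proof. by move=> phi; rewrite -dist_map_comp /= !affineP. Qed.

Definition aff_comp (A B C : convex R) (g : affine B C) (f : affine A B)
    : affine A C :=
  Affine (comp_affine g f).

Lemma aff_compE (A B C : convex R) (g : affine B C) (f : affine A B) a :
  aff_comp g f a = g (f a).
Proof. by []. Qed.

(* The free convex set on [X]. *)
Lemma free_bary_ret (X : Type) (phi : dist R X) :
  dist_join (dist_ret R phi) = phi.
Proof. exact: bind_ret. Qed.

Lemma free_bary_join (X : Type) (Phi : dist R (dist R (dist R X))) :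
  dist_join (dist_join Phi) = dist_join (dist_map (@dist_join R X) Phi).
Proof. by rewrite /dist_join bind_bind bind_map. Qed.

Definition free_conv (X : Type) : convex R :=
  Convex (@free_bary_ret X) (@free_bary_join X).

(* The unit interval, with expected value as barycentre. *)
Definition i01_bary (phi : dist R {i01 R}) : {i01 R} :=
  Itv01 (expect_ge0 phi (@i01_ge0 R)) (expect_le1 phi (@i01_le1 R)).

Lemma i01_bary_ret (a : {i01 R}) : i01_bary (dist_ret R a) = a.
Proof. by apply/val_inj; exact: expect_ret. Qed.

Lemma i01_bary_join (Phi : dist R (dist R {i01 R})) :
  i01_bary (dist_join Phi) = i01_bary (dist_map i01_bary Phi).
Proof. by apply/val_inj; rewrite /= expect_bind expect_map. Qed.

Definition I01 : convex R := Convex i01_bary_ret i01_bary_join.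

End Affine.

(** * The tensor product of convex sets *)

Definition congruence (R : realType) (A : convex R) (E : A -> A -> Prop) : Prop :=
  [/\ forall a, E a a, forall a b, E a b -> E b a,
      forall a b c, E a b -> E b c -> E a c &
      forall (I : Type) (phi : dist R I) (f g : I -> A),
        (forall i, E (f i) (g i)) ->
        E (bary (dist_map f phi)) (bary (dist_map g phi))].

Section Tensor.
Context (R : realType) (A B : convex R).

(* The least congruence on the free convex set on [A * B] that identifies the
   two sides of the equations making [(a, b) |-> a (x) b] affine in each
   argument; the tensor product is the quotient by it. *)
Definition tensor_rel (u v : free_conv R (A * B)) : Prop :=
  forall E : free_conv R (A * B) -> free_conv R (A * B) -> Prop, congruence E ->
    (forall (phi : dist R A) (b : B),
       E (dist_ret R (bary phi, b)) (dist_map (fun a => (a, b)) phi)) ->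
    (forall (a : A) (psi : dist R B),
       E (dist_ret R (a, bary psi)) (dist_map (fun b => (a, b)) psi)) ->
    E u v.

Lemma tensor_rel_congruence : congruence tensor_rel.
Proof.
split=> [u E [r _ _ _] _ _|u v uv E Ec El Er|u v w uv vw E Ec El Er
        |I phi f g fg E Ec El Er]; first exact: r.
- by case: (Ec) => _ s _ _; apply: s; exact: uv.
- by case: (Ec) => _ _ t _; apply: t (uv _ Ec El Er) (vw _ Ec El Er).
- by case: (Ec) => _ _ _; apply=> i; exact: fg.
Qed.

Definition tensor_pt : Type :=
  {P : free_conv R (A * B) -> Prop | exists u, P = tensor_rel u}.

Definition tclass (u : free_conv R (A * B)) : tensor_pt :=
  exist _ (tensor_rel u) (ex_intro _ u erefl).

Definition trepr (t : tensor_pt) : free_conv R (A * B) := projT1 (cid (proj2_sig t)).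

Lemma treprK t : tclass (trepr t) = t.
Proof.
case: t => P hP; rewrite /trepr /=; case: cid => u /= uE.
by apply: eq_exist => /=; rewrite uE.
Qed.

Lemma tclass_eq u v : tensor_rel u v -> tclass u = tclass v.
Proof.
move=> uv; apply: eq_exist => /=; apply/funext => w; apply/propext.
have [_ s t _] := tensor_rel_congruence.
by split=> [uw|vw]; [exact: t (s _ _ uv) uw | exact: t uv vw].
Qed.

Lemma trepr_rel u : tensor_rel (trepr (tclass u)) u.
Proof.
have e : tensor_rel (trepr (tclass u)) = tensor_rel u.
  exact: (congr1 (@sval _ _) (treprK (tclass u))).
by rewrite e; case: tensor_rel_congruence.
Qed.

Definition tensor_bary (p : dist R tensor_pt) : tensor_pt :=
  tclass (dist_join (dist_map trepr p)).

Lemma tensor_bary_class (I : Type) (phi : dist R I) (f : I -> free_conv R (A * B)) :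
  tensor_bary (dist_map (tclass \o f) phi) = tclass (dist_bind phi f).
Proof.
rewrite /tensor_bary dist_map_comp; apply: tclass_eq.
have [_ _ _ c] := tensor_rel_congruence.
have -> : dist_bind phi f = dist_join (dist_map f phi) by rewrite /dist_join bind_map.
by apply: (c I phi) => i; exact: trepr_rel.
Qed.

Lemma tensor_bary_ret t : tensor_bary (dist_ret R t) = t.
Proof. by rewrite /tensor_bary map_ret free_bary_ret treprK. Qed.

Lemma tensor_bary_join Phi :
  tensor_bary (dist_join Phi) = tensor_bary (dist_map tensor_bary Phi).
Proof.
rewrite -[RHS]/(tensor_bary
  (dist_map (tclass \o (fun p => dist_join (dist_map trepr p))) Phi)).
by rewrite tensor_bary_class /tensor_bary map_join /dist_join bind_bind bind_map.
Qed.

Definition tensor : convex R := Convex tensor_bary_ret tensor_bary_join.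

Definition pure (a : A) (b : B) : tensor := tclass (dist_ret R (a, b)).

Lemma pure_biaffine : is_biaffine pure.
Proof.
split=> [b phi|a psi].
- have -> : dist_map (fun a => pure a b) phi =
    dist_map (tclass \o (fun a => dist_ret R (a, b))) phi by [].
  by rewrite /= tensor_bary_class; apply: tclass_eq => E _ El _; exact: El.
- have -> : dist_map (pure a) psi =
    dist_map (tclass \o (fun b => dist_ret R (a, b))) psi by [].
  by rewrite /= tensor_bary_class; apply: tclass_eq => E _ _ Er; exact: Er.
Qed.

Lemma pure_gen (t : tensor) :
  t = bary (dist_map (fun p => pure p.1 p.2) (trepr t)).
Proof.
have -> : dist_map (fun p => pure p.1 p.2) (trepr t) =
    dist_map (tclass \o @dist_ret R (A * B)) (trepr t).
  by congr dist_map; apply/funext => -[].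
by rewrite /= tensor_bary_class bindr_ret treprK.
Qed.

Lemma tensor_ext (C : convex R) (f g : affine tensor C) :
  (forall a b, f (pure a b) = g (pure a b)) -> f = g.
Proof.
move=> fg; apply: affine_ext => t; rewrite (pure_gen t) !affineP !dist_map_comp.
by congr (bary (dist_map _ _)); apply/funext => p /=; exact: fg.
Qed.

Section Rec.
Context (C : convex R) (f : A -> B -> C) (fP : is_biaffine f).

Definition tensor_ext_fun (u : free_conv R (A * B)) : C :=
  bary (dist_map (fun p => f p.1 p.2) u).

Lemma tensor_ext_fun_rel u v :
  tensor_rel u v -> tensor_ext_fun u = tensor_ext_fun v.
Proof.
move=> uv; apply: (uv (fun u v => tensor_ext_fun u = tensor_ext_fun v));
  first split=> //.
- by move=> x y z -> ->.
- move=> I phi g h gh; rewrite /tensor_ext_fun /= !map_join !bary_join !dist_map_comp.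
  by congr (bary (dist_map _ _)); apply/funext => i; exact: gh.
- move=> phi b; rewrite /tensor_ext_fun map_ret bary_ret dist_map_comp /=.
  exact: (fP.1 b).
- move=> a psi; rewrite /tensor_ext_fun map_ret bary_ret dist_map_comp /=.
  exact: (fP.2 a).
Qed.

Definition tensor_rec_fun (t : tensor) : C := tensor_ext_fun (trepr t).

Lemma tensor_rec_fun_affine : is_affine tensor_rec_fun.
Proof.
move=> p; rewrite /tensor_rec_fun (tensor_ext_fun_rel (trepr_rel _)).
by rewrite /tensor_ext_fun map_join bary_join !dist_map_comp.
Qed.

(* The universal property of the tensor product, with [tensor_recE] for
   existence and [tensor_ext] for uniqueness. *)
Definition tensor_rec : affine tensor C := Affine tensor_rec_fun_affine.

Lemma tensor_recE a b : tensor_rec (pure a b) = f a b.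
Proof.
rewrite /= /tensor_rec_fun (tensor_ext_fun_rel (trepr_rel _)).
by rewrite /tensor_ext_fun map_ret bary_ret.
Qed.

End Rec.

End Tensor.

Section TensorMap.
Context (R : realType).

Lemma tensor_map_biaffine (A A' B B' : convex R)
    (f : affine A A') (g : affine B B') :
  is_biaffine (fun a b => pure (f a) (g b)).
Proof.
split=> [b phi|a psi]; rewrite affineP.
- by rewrite (pure_biaffine _ _).1 dist_map_comp.
- by rewrite (pure_biaffine _ _).2 dist_map_comp.
Qed.

Definition tensor_map (A A' B B' : convex R) (f : affine A A') (g : affine B B')
    : affine (tensor A B) (tensor A' B') :=
  tensor_rec (tensor_map_biaffine f g).

Lemma tensor_mapE (A A' B B' : convex R) (f : affine A A') (g : affine B B') a b :
  tensor_map f g (pure a b) = pure (f a) (g b).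
Proof. exact: tensor_recE. Qed.

End TensorMap.

(** * Relations with values in the unit interval *)

Section Hat.
Context (R : realType) (X Y : Type) (r : X * Y -> {i01 R}).

Definition hat_val (phi : dist R X) (psi : dist R Y) : R :=
  fsum (fun x => fsum (fun y => (phi x)%:num * (r (x, y))%:num * (psi y)%:num)).

Lemma hat_valE phi psi : hat_val phi psi =
  expect phi (fun x => expect psi (fun y => (r (x, y))%:num)).
Proof.
have [t [ut t0]] := dist_seq psi.
apply: eq_fsum => x; rewrite (expect_seq _ ut t0) (@fsum_seq _ _ t)//.
  by rewrite mulr_sumr; apply: eq_bigr => y _; rewrite mulrAC mulrA.
by move=> y /t0 ->; rewrite mulr0.
Qed.

Lemma hat_valC phi psi : hat_val phi psi =
  expect psi (fun y => expect phi (fun x => (r (x, y))%:num)).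
Proof.
have [s [us s0]] := dist_seq phi; have [t [ut t0]] := dist_seq psi.
rewrite hat_valE (expect_seq _ us s0) (expect_seq _ ut t0).
under eq_bigr do rewrite (expect_seq _ ut t0) mulr_sumr.
under [RHS]eq_bigr do rewrite (expect_seq _ us s0) mulr_sumr.
by rewrite exchange_big; do 2!(apply: eq_bigr => ? _); rewrite mulrCA.
Qed.

Lemma hat_val_ge0 phi psi : 0 <= hat_val phi psi.
Proof. by rewrite hat_valE; do 2!(apply: expect_ge0 => ?). Qed.

Lemma hat_val_le1 phi psi : hat_val phi psi <= 1.
Proof. by rewrite hat_valE; do 2!(apply: expect_le1 => ?). Qed.

Definition hat_fun (phi : free_conv R X) (psi : free_conv R Y) : I01 R :=
  Itv01 (hat_val_ge0 phi psi) (hat_val_le1 phi psi).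

Lemma hat_biaffine : is_biaffine hat_fun.
Proof.
split=> [psi Phi|phi Psi]; apply/val_inj; rewrite /= expect_map.
- by rewrite hat_valE expect_bind; apply: eq_expect => phi /=; rewrite hat_valE.
- by rewrite hat_valC expect_bind; apply: eq_expect => psi /=; rewrite hat_valC.
Qed.

Definition hat : affine (tensor (free_conv R X) (free_conv R Y)) (I01 R) :=
  tensor_rec hat_biaffine.

End Hat.

Section Comparison.
Context (R : realType) (X : Type).

Definition cp_val (phi psi : dist R X) : R :=
  fsum (fun x => (phi x)%:num * (psi x)%:num).

Lemma cp_valC phi psi : cp_val phi psi = cp_val psi phi.
Proof. by apply: eq_fsum => x; rewrite mulrC. Qed.

Lemma cp_val_ge0 phi psi : 0 <= cp_val phi psi.
Proof. by apply: expect_ge0. Qed.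

Lemma cp_val_le1 phi psi : cp_val phi psi <= 1.
Proof. by apply: expect_le1. Qed.

Definition cp_fun (phi psi : free_conv R X) : I01 R :=
  Itv01 (cp_val_ge0 phi psi) (cp_val_le1 phi psi).

Lemma cp_biaffine : is_biaffine cp_fun.
Proof.
have l (psi : free_conv R X) : is_affine (fun phi => cp_fun phi psi).
  by move=> Phi; apply/val_inj; rewrite /= expect_map [LHS]expect_bind.
split=> // phi Psi.
have -> : cp_fun phi = fun psi => cp_fun psi phi.
  by apply/funext => psi; apply/val_inj; rewrite /= cp_valC.
exact: l.
Qed.

Definition cp : affine (tensor (free_conv R X) (free_conv R X)) (I01 R) :=
  tensor_rec cp_biaffine.

Lemma cpC phi psi : cp (pure phi psi) = cp (pure psi phi).
Proof. by rewrite !tensor_recE; apply/val_inj; rewrite /= cp_valC. Qed.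

Lemma cp_inj (phi phi' : free_conv R X) :
  (forall psi, cp (pure phi psi) = cp (pure phi' psi)) -> phi = phi'.
Proof.
move=> e; apply: dist_ext => x; have := congr1 val (e (dist_ret R x)).
rewrite !tensor_recE /= ![cp_val _ (dist_ret R x)]cp_valC.
by rewrite [LHS](expect_ret x) [RHS](expect_ret x).
Qed.

End Comparison.

(** * Tame relations *)

(* For a tame relation [r], [lower r] and [upper r] are the maps written r_*
   and r^*; they are unique by [lower_unique] and [upper_unique]. *)

Section Tame.
Context (R : realType).

Definition tame (X Y : Type) (r : affine (tensor (free_conv R X) (free_conv R Y)) (I01 R))
    : Prop :=
  exists (f : affine (free_conv R X) (free_conv R Y)) (g : affine (free_conv R Y) (free_conv R X)),
    aff_comp (cp R Y) (tensor_map f (aff_id (free_conv R Y))) = r /\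
    aff_comp (cp R X) (tensor_map (aff_id (free_conv R X)) g) = r.

Definition trel (X Y : Type) : Type :=
  {r : affine (tensor (free_conv R X) (free_conv R Y)) (I01 R) | tame r}.

Definition lower (X Y : Type) (r : trel X Y) : affine (free_conv R X) (free_conv R Y) :=
  projT1 (cid (proj2_sig r)).

Definition upper (X Y : Type) (r : trel X Y) : affine (free_conv R Y) (free_conv R X) :=
  projT1 (cid (projT2 (cid (proj2_sig r)))).

Lemma lowerP (X Y : Type) (r : trel X Y) :
  aff_comp (cp R Y) (tensor_map (lower r) (aff_id _)) = sval r.
Proof. by rewrite /lower; case: cid => f /= [g []]. Qed.

Lemma upperP (X Y : Type) (r : trel X Y) :
  aff_comp (cp R X) (tensor_map (aff_id _) (upper r)) = sval r.
Proof. exact: (projT2 (cid (projT2 (cid (proj2_sig r))))).2. Qed.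

Lemma lowerE (X Y : Type) (r : trel X Y) phi psi :
  cp R Y (pure (lower r phi) psi) = sval r (pure phi psi).
Proof. by rewrite -lowerP aff_compE tensor_mapE. Qed.

Lemma upperE (X Y : Type) (r : trel X Y) phi psi :
  cp R X (pure phi (upper r psi)) = sval r (pure phi psi).
Proof. by rewrite -upperP aff_compE tensor_mapE. Qed.

Lemma lower_unique (X Y : Type) (r : trel X Y) (f : affine (free_conv R X) (free_conv R Y)) :
  aff_comp (cp R Y) (tensor_map f (aff_id _)) = sval r -> lower r = f.
Proof.
move=> fr; apply: affine_ext => phi; apply: cp_inj => psi.
by rewrite lowerE -fr aff_compE tensor_mapE.
Qed.

Lemma upper_unique (X Y : Type) (r : trel X Y) (g : affine (free_conv R Y) (free_conv R X)) :
  aff_comp (cp R X) (tensor_map (aff_id _) g) = sval r -> upper r = g.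
Proof.
move=> gr; apply: affine_ext => psi; apply: cp_inj => phi.
by rewrite cpC upperE -gr cpC aff_compE tensor_mapE.
Qed.

Lemma trel_ext (X Y : Type) (r s : trel X Y) :
  (forall phi psi, sval r (pure phi psi) = sval s (pure phi psi)) -> r = s.
Proof. by case: r s => r rP [s sP] /= rs; apply: eq_exist; apply: tensor_ext. Qed.

Lemma tame_cp (X : Type) : tame (cp R X).
Proof.
by exists (aff_id _), (aff_id _); split; apply: tensor_ext => phi psi;
  rewrite aff_compE tensor_mapE.
Qed.

Definition trel_id (X : Type) : trel X X := exist _ (cp R X) (tame_cp X).

Lemma tame_comp (X Y Z : Type) (s : trel Y Z) (r : trel X Y) :
  tame (aff_comp (sval s) (tensor_map (lower r) (aff_id (free_conv R Z)))).
Proof.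
exists (aff_comp (lower s) (lower r)), (aff_comp (upper r) (upper s)).
split; apply: tensor_ext => phi chi; rewrite !aff_compE !tensor_mapE ?aff_compE.
  exact: lowerE.
by rewrite [LHS]upperE -lowerE -upperE.
Qed.

Definition trel_comp (X Y Z : Type) (s : trel Y Z) (r : trel X Y) : trel X Z :=
  exist _ _ (tame_comp s r).

Lemma tame_dagger (X Y : Type) (r : trel X Y) :
  tame (aff_comp (cp R X) (tensor_map (upper r) (aff_id (free_conv R X)))).
Proof.
exists (upper r), (lower r); split => //.
apply: tensor_ext => psi phi; rewrite !aff_compE !tensor_mapE ?aff_compE.
by rewrite [LHS]cpC lowerE [RHS]cpC upperE.
Qed.

Definition trel_dagger (X Y : Type) (r : trel X Y) : trel Y X :=
  exist _ _ (tame_dagger r).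

Lemma trel_compE (X Y Z : Type) (s : trel Y Z) (r : trel X Y) phi chi :
  sval (trel_comp s r) (pure phi chi) = sval s (pure (lower r phi) chi).
Proof. by rewrite aff_compE tensor_mapE. Qed.

Lemma trel_daggerE (X Y : Type) (r : trel X Y) psi phi :
  sval (trel_dagger r) (pure psi phi) = sval r (pure phi psi).
Proof. by rewrite aff_compE tensor_mapE cpC upperE. Qed.

Lemma lower_id (X : Type) : lower (trel_id X) = aff_id (free_conv R X).
Proof.
by apply: lower_unique; apply: tensor_ext => phi psi; rewrite aff_compE tensor_mapE.
Qed.

Lemma lower_comp (X Y Z : Type) (s : trel Y Z) (r : trel X Y) :
  lower (trel_comp s r) = aff_comp (lower s) (lower r).
Proof.
apply: lower_unique; apply: tensor_ext => phi chi.
by rewrite !aff_compE !tensor_mapE aff_compE lowerE.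
Qed.

Lemma trel_comp1 (X Y : Type) (r : trel X Y) : trel_comp r (trel_id X) = r.
Proof. by apply: trel_ext => phi psi; rewrite trel_compE lower_id. Qed.

Lemma trel_1comp (X Y : Type) (r : trel X Y) : trel_comp (trel_id Y) r = r.
Proof. by apply: trel_ext => phi psi; rewrite trel_compE lowerE. Qed.

Lemma trel_compA (X Y Z W : Type) (t : trel Z W) (s : trel Y Z) (r : trel X Y) :
  trel_comp t (trel_comp s r) = trel_comp (trel_comp t s) r.
Proof. by apply: trel_ext => phi psi; rewrite !trel_compE lower_comp. Qed.

Lemma trel_dagger_id (X : Type) : trel_dagger (trel_id X) = trel_id X.
Proof. by apply: trel_ext => phi psi; rewrite trel_daggerE [LHS]cpC. Qed.

Lemma trel_daggerK (X Y : Type) (r : trel X Y) : trel_dagger (trel_dagger r) = r.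
Proof. by apply: trel_ext => phi psi; rewrite !trel_daggerE. Qed.

Lemma lower_dagger (X Y : Type) (r : trel X Y) : lower (trel_dagger r) = upper r.
Proof. by apply: lower_unique. Qed.

Lemma trel_dagger_comp (X Y Z : Type) (s : trel Y Z) (r : trel X Y) :
  trel_dagger (trel_comp s r) = trel_comp (trel_dagger r) (trel_dagger s).
Proof.
apply: trel_ext => chi phi; rewrite trel_daggerE !trel_compE trel_daggerE.
by rewrite lower_dagger -[LHS]upperE lowerE.
Qed.

End Tame.

(** * Dagger categories *)

Record dagger_category := DaggerCategory {
  cat_obj : Type;
  cat_hom : cat_obj -> cat_obj -> Type;
  cat_id : forall X, cat_hom X X;
  cat_comp : forall X Y Z, cat_hom Y Z -> cat_hom X Y -> cat_hom X Z;
  cat_dagger : forall X Y, cat_hom X Y -> cat_hom Y X;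
  cat_comp1m : forall X Y (f : cat_hom X Y), cat_comp (cat_id Y) f = f;
  cat_compm1 : forall X Y (f : cat_hom X Y), cat_comp f (cat_id X) = f;
  cat_compA : forall X Y Z W (h : cat_hom Z W) (g : cat_hom Y Z) (f : cat_hom X Y),
    cat_comp h (cat_comp g f) = cat_comp (cat_comp h g) f;
  cat_dagger1 : forall X, cat_dagger (cat_id X) = cat_id X;
  cat_dagger_comp : forall X Y Z (g : cat_hom Y Z) (f : cat_hom X Y),
    cat_dagger (cat_comp g f) = cat_comp (cat_dagger f) (cat_dagger g);
  cat_daggerK : forall X Y (f : cat_hom X Y), cat_dagger (cat_dagger f) = f }.

Definition Sets := Type.

Definition TRel (R : realType) : dagger_category := {|
  cat_obj := Sets;
  cat_hom := fun X Y : Sets => trel R X Y;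
  cat_id := @trel_id R;
  cat_comp := @trel_comp R;
  cat_dagger := @trel_dagger R;
  cat_comp1m := @trel_1comp R;
  cat_compm1 := @trel_comp1 R;
  cat_compA := @trel_compA R;
  cat_dagger1 := @trel_dagger_id R;
  cat_dagger_comp := @trel_dagger_comp R;
  cat_daggerK := @trel_daggerK R |}.

(** * Discrete bistochastic relations *)

Definition factors_through_dist (R : realType) (X Y : Type)
    (f : X -> (Y -> {i01 R})) : Prop :=
  exists g : X -> dist R Y, f = @prob R Y \o g.

Definition bistochastic (R : realType) (X Y : Type) (r : X * Y -> {i01 R}) : Prop :=
  factors_through_dist (fun x y => r (x, y)) /\
  factors_through_dist (fun y x => r (x, y)).

(* Main.v *)
Require Import Defs.
From mathcomp Require Import all_boot all_order all_algebra.
From mathcomp Require Import boolp.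
From mathcomp Require Import reals interval_inference.

(* An affine map out of [D(X) (x) D(Y)] is determined by its values on pure
   tensors of Dirac distributions, and [r^] takes the value [r (x, y)] there.
   Pairing with the Dirac distribution at [y] under [cp] evaluates at [y], so
   [r_*] restricted to Dirac distributions is exactly a factorisation of
   [x |-> r (x, -)] through [D(Y)], and conversely such a factorisation
   extends to [r_*] by freeness of [D(X)]; [r^*] is symmetric. *)

Section TameBistochastic.
Context (R : realType).

Local Notation pure_ret x y :=
  (@pure R (free_conv R _) (free_conv R _) (dist_ret R x) (dist_ret R y)).

Lemma bind_affine (X Y : Type) (k : X -> dist R Y) :
  @is_affine R (free_conv R X) (free_conv R Y) (fun phi => dist_bind phi k).
Proof. by move=> Phi; rewrite /= /dist_join bind_bind bind_map. Qed.

(** The Kleisli extension of [k]: by [bind_ret] and [free_ext], the only affine map that agrees with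
    [k] on Dirac distributions. *)
Definition aff_bind (X Y : Type) (k : X -> dist R Y) :
  affine (free_conv R X) (free_conv R Y) := Affine (bind_affine _ _ k).

(** By the right unit law of the monad, [phi] is the barycentre of the Dirac distributions with
    weights [phi], and affine maps preserve barycentres. *)
Lemma free_ext (X : Type) (C : convex R) (f g : free_conv R X -> C) :
  is_affine f -> is_affine g ->
  (forall x, f (dist_ret R x) = g (dist_ret R x)) -> f =1 g.
Proof.
move=> fP gP fg phi.
have -> : phi = @bary R (free_conv R X) (dist_map (@dist_ret R X) phi).
  by rewrite /= /dist_join bind_map; exact/esym/bindr_ret.
rewrite fP gP !dist_map_comp.
by congr (bary (dist_map _ _)); apply/funext.
Qed.

Lemma tensor_free_ext (X Y : Type) (C : convex R)
    (f g : affine (tensor (free_conv R X) (free_conv R Y)) C) :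
  (forall x y, f (pure_ret x y) = g (pure_ret x y)) -> f = g.
Proof.
have pure_affine (h : affine (tensor (free_conv R X) (free_conv R Y)) C) :
    is_biaffine (fun phi psi => h (pure phi psi)).
  split=> [psi Phi|phi Psi].
    by rewrite (pure_biaffine _ _).1 affineP dist_map_comp.
  by rewrite (pure_biaffine _ _).2 affineP dist_map_comp.
move=> fg; apply: tensor_ext => phi psi.
(* Fixing one argument of a pure tensor leaves an affine map in the other, so [free_ext] applies to
   each variable in turn. *)
apply: (free_ext _ _ (fun phi => f (pure phi psi)) (fun phi => g (pure phi psi)));
  [exact: (pure_affine f).1 | exact: (pure_affine g).1 | move=> x].
by apply: (free_ext _ _ (fun psi => f (pure _ psi)) (fun psi => g (pure _ psi)));
  [exact: (pure_affine f).2 | exact: (pure_affine g).2 |].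
Qed.

(** Symmetry moves the Dirac distribution to the first slot, where the sum is an expectation under
    it. *)
Lemma cp_retr (X : Type) (phi : dist R X) (x : X) :
  cp R X (@pure R (free_conv R X) (free_conv R X) phi (dist_ret R x)) = phi x.
Proof. by rewrite tensor_recE; apply/val_inj; rewrite /= cp_valC; exact: expect_ret. Qed.

Lemma cp_retl (X : Type) (phi : dist R X) (x : X) :
  cp R X (@pure R (free_conv R X) (free_conv R X) (dist_ret R x) phi) = phi x.
Proof. by rewrite cpC cp_retr. Qed.

Lemma hat_ret (X Y : Type) (r : X * Y -> {i01 R}) x y :
  hat r (pure_ret x y) = r (x, y).
Proof.
by rewrite tensor_recE; apply/val_inj; rewrite /= hat_valE !expect_ret.
Qed.

Lemma tame_hat (X Y : Type) (r : X * Y -> {i01 R}) :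
  bistochastic r -> tame (hat r).
Proof.
case=> -[f fr] [g gr]; exists (aff_bind X Y f), (aff_bind Y X g).
(* Both tameness equations relate affine maps, so Dirac distributions suffice. *)
split; apply: tensor_free_ext => x y; rewrite aff_compE tensor_mapE hat_ret /=.
  rewrite bind_ret; apply: (etrans (cp_retr _ _ _)).
  exact: (esym (congr1 (fun h => h x y) fr)).
rewrite bind_ret; apply: (etrans (cp_retl _ _ _)).
exact: (esym (congr1 (fun h => h y x) gr)).
Qed.

(** The inverse of [hat] on tame relations. *)
Definition trel_fun (X Y : Type) (t : trel R X Y) (p : X * Y) : {i01 R} :=
  sval t (pure_ret p.1 p.2).

Lemma hat_trel_fun (X Y : Type) (t : trel R X Y) : hat (trel_fun X Y t) = sval t.
Proof. by apply: tensor_free_ext => x y; rewrite hat_ret. Qed.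

Lemma bistochastic_trel_fun (X Y : Type) (t : trel R X Y) :
  bistochastic (trel_fun X Y t).
Proof.
split.
  exists (fun x => lower t (dist_ret R x)); apply/funext => x; apply/funext => y.
  by rewrite /trel_fun -lowerE cp_retr.
exists (fun y => upper t (dist_ret R y)); apply/funext => y; apply/funext => x.
by rewrite /trel_fun -upperE cp_retl.
Qed.

End TameBistochastic.

Theorem proposition4p5 (R : realType) :
  cat_obj (TRel R) = Sets /\
  forall X Y : Sets,
    exists F : {r : X * Y -> {i01 R} | bistochastic r} -> @cat_hom (TRel R) X Y,
      bijective F /\ forall r, sval (F r) = hat (sval r).
Proof.
split=> // X Y.
exists (fun r => exist _ (hat (sval r)) (tame_hat R X Y _ (proj2_sig r))).
split=> //.
exists (fun t => exist _ (trel_fun R X Y t) (bistochastic_trel_fun R X Y t)).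
  (* Both round trips compare first components only, the proofs of [bistochastic] and [tame] being
     irrelevant. *)
  by case=> r rP; apply: eq_exist; apply/funext => -[x y]; exact: hat_ret.
by case=> t tP; apply: eq_exist; exact: (hat_trel_fun R X Y (exist _ t tP)).
Qed.
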